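(* For any prime $p\ge 2$ we have $$F\big(\mathbb Z_{p-1}^3,\mathcal L^{(3)}_{2,2,2}\big)\ge (p-3)^2.$$
   Context: $\mathbb Z_m$ denotes the cyclic group $\mathbb Z/m\mathbb Z$. For an abelian group $G$, a set $A\subset G$ is called $\mathcal L^{(3)}_{2,2,2}$-free if $A$ contains no sumset $L_1+L_2+L_3=\{\lambda_1+\lambda_2+\lambda_3:\lambda_i\in L_i\}$ with $L_i\subset G$ and $|L_1|=|L_2|=|L_3|=2$. (The sums need not be pairwise distinct.) For a finite abelian group $G$, $F(G,\mathcal L^{(3)}_{2,2,2})$ denotes the largest size of an $\mathcal L^{(3)}_{2,2,2}$-free set in $G$. *)

(* Defs.v *)
From HB Require Import structures.
From mathcomp Require Import all_boot all_order all_algebra.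
Set Implicit Arguments.
Unset Strict Implicit.
Unset Printing Implicit Defensive.
Import GRing.Theory.
Local Open Scope ring_scope.

(* For m > 0, 'I_m.-1.+1 is 'I_m with addition modulo m.  Unlike 'Z_m, it is  *)
(* the trivial group for m = 1.                                               *)
Definition Zmod (m : nat) : finZmodType := 'I_m.-1.+1.

Section Sumsets.

Variable G : finZmodType.
Implicit Types A B L : {set G}.

Definition sumset A B : {set G} := [set a + b | a in A, b in B].

Definition L222_free A : bool :=
  [forall L1 : {set G}, forall L2 : {set G}, forall L3 : {set G},
     [&& #|L1| == 2, #|L2| == 2 & #|L3| == 2] ==>
     ~~ (sumset (sumset L1 L2) L3 \subset A)].

End Sumsets.

(* The empty set is L222_free, so the maximum is over a nonempty family. *)
Definition F_L222 (G : finZmodType) : nat :=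
  \max_(A : {set G} | L222_free A) #|A|.

(* Main.v *)
Require Import Defs.
From mathcomp Require Import all_boot all_order all_algebra.
From mathcomp Require Import cyclic finfield.
From mathcomp Require Import zify ring.
Import Order.TTheory GRing.Theory Num.Theory.
Local Open Scope ring_scope.

(** Let F be a field with q elements, q odd, and g a generator of its
    multiplicative group.  Taking powers of g coordinatewise identifies
    (Z/(q - 1))^3 with the group of triples of nonzero elements of F under
    multiplication, where a sumset L1 + L2 + L3 of pairs becomes a product of
    three pairs of triples.  The free set is the part of the plane
    x0 + x1 + x2 = 1 on which no coordinate is 0 or 1.

    Suppose that this plane contains all eight products.  Factor out one of
    them, a, and let 1, 1 + u, resp. 1, 1 + v and 1, 1 + w, be the normalized
    pairs.  Differencing the eight equations shows that, for the bilinear form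
    <X, Y> = a0 X0 Y0 + a1 X1 Y1 + a2 X2 Y2, the vectors u, v, w and all their
    coordinatewise products are orthogonal to 1, while <1, 1> = 1.  As v is not
    constant, the vectors orthogonal to both 1 and v form a line
    ([ortho_line]); it contains u, w and u w.  So w = b u and u w = t u, whence
    w takes only the values 0 and t, and the a_i with w_i = t have sum 0.
    Since the a_i are nonzero with sum 1, exactly two of them cancel and the
    third is 1, which is excluded ([box_in_plane]).

    The plane section has at least (q - 3)^2 points ([card_plane_section_ge]):
    the first coordinate x is not 0 or 1, and the second avoids 0, 1, 1 - x and
    -x.  These are at most four values, and at most three when x = -1, so there
    are at least (q - 3)(q - 4) + (q - 3) points.  The prime 2, where the group
    is trivial and contains no pair at all, is separate. *)

(** * Products of three pairs in a plane *)

(** The common kernel of two independent linear forms on F^3 has dimension 1, so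
    any nonzero vector of it spans it. *)
Lemma ortho_line (F : fieldType) (f g X Y : 'rV[F]_3) :
    f != 0 -> (forall c, g != c *: f) ->
    X != 0 -> X *m f^T = 0 -> X *m g^T = 0 ->
    Y *m f^T = 0 -> Y *m g^T = 0 ->
  exists c, Y = c *: X.
Proof.
move=> f0 gf X0 Xf Xg Yf Yg.
have inK (Z : 'rV[F]_3) :
    Z *m f^T = 0 -> Z *m g^T = 0 -> (Z <= kermx (col_mx f g)^T)%MS.
  by move=> Zf Zg; rewrite sub_kermx tr_col_mx mul_mx_row Zf Zg row_mx0.
have rank_fg : (1 < \rank (col_mx f g))%N.
  have {1}-> : 1%N = \rank f by rewrite rank_rV f0.
  rewrite -addsmxE rank_ltmx // /ltmx addsmxSl addsmx_sub submx_refl /=.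
  by apply/negP => /sub_rVP[c gE]; have := gf c; rewrite gE eqxx.
have XK : (X == kermx (col_mx f g)^T)%MS.
  rewrite -(geq_leqif (mxrank_leqif_eq (inK X Xf Xg))).
  rewrite rank_rV X0 mxrank_ker mxrank_tr; lia.
by apply/sub_rVP; rewrite (eqmxP XK) inK.
Qed.

Lemma sum3 (F : fieldType) (f : 'I_3 -> F) :
  \sum_i f i = f 0 + f 1 + f 2%:R.
Proof.
by rewrite !big_ord_recr big_ord0 /= add0r; congr (f _ + f _ + f _); apply/val_inj.
Qed.

(** For the bilinear form with weights a, the vectors u, w and u w lie on the
    line orthogonal to 1 and v, which makes w constant on its support; the a_i
    on that support cancel, and this leaves a single a_i equal to 1. *)
Lemma box_in_plane_normalized (F : fieldType) (a u v w : 'rV[F]_3) :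
    (forall i, a 0 i != 0) -> \sum_i a 0 i = 1 ->
    u != 0 -> v != 0 -> w != 0 ->
    \sum_i a 0 i * u 0 i = 0 -> \sum_i a 0 i * v 0 i = 0 ->
    \sum_i a 0 i * w 0 i = 0 -> \sum_i a 0 i * (u 0 i * v 0 i) = 0 ->
    \sum_i a 0 i * (v 0 i * w 0 i) = 0 -> \sum_i a 0 i * (u 0 i * w 0 i) = 0 ->
    \sum_i a 0 i * (u 0 i * v 0 i * w 0 i) = 0 ->
  exists i, a 0 i = 1.
Proof.
move=> a0 a1 u0 v0 w0 au av aw auv avw auw auvw.
pose g : 'rV[F]_3 := \row_i (a 0 i * v 0 i).
have aN0 : a != 0.
  by apply/eqP => aE; have := a0 0; rewrite aE mxE eqxx.
(* g = c a would make v constant, and a constant vector orthogonal to 1 is 0. *)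
have ga c : g != c *: a.
  apply/eqP => /rowP gE.
  have vE i : v 0 i = c.
    by apply: (mulfI (a0 i)); move: (gE i); rewrite !mxE mulrC => ->; rewrite mulrC.
  have c0 : c = 0.
    rewrite -av (eq_bigr (fun i => a 0 i * c)) => [|i _]; last by rewrite vE.
    by rewrite -mulr_suml a1 mul1r.
  by case/eqP: v0; apply/rowP => i; rewrite vE c0 mxE.
have dotE (X Y : 'rV[F]_3) : \sum_i X 0 i * Y 0 i = 0 -> Y *m X^T = 0.
  move=> XY; apply/matrixP => i j; rewrite !ord1 !mxE -[RHS]XY.
  by apply: eq_bigr => k _; rewrite mxE mulrC.
have ua : u *m a^T = 0 by apply: dotE.
have ug : u *m g^T = 0.
  by apply: dotE; rewrite -[RHS]auv; apply: eq_bigr => i _; rewrite mxE; ring.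
have wa : w *m a^T = 0 by apply: dotE.
have wg : w *m g^T = 0.
  by apply: dotE; rewrite -[RHS]avw; apply: eq_bigr => i _; rewrite mxE; ring.
pose uw : 'rV[F]_3 := \row_i (u 0 i * w 0 i).
have uwa : uw *m a^T = 0.
  by apply: dotE; rewrite -[RHS]auw; apply: eq_bigr => i _; rewrite mxE.
have uwg : uw *m g^T = 0.
  by apply: dotE; rewrite -[RHS]auvw; apply: eq_bigr => i _; rewrite !mxE; ring.
(* w = b u and u w = t u give w w = b u w = t b u = t w. *)
have [b /rowP wE] := ortho_line _ _ _ _ _ aN0 ga u0 ua ug wa wg.
have [t /rowP uwE] := ortho_line _ _ _ _ _ aN0 ga u0 ua ug uwa uwg.
have wV i : w 0 i = 0 \/ w 0 i = t.
  have : w 0 i * (w 0 i - t) = 0.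
    by have := uwE i; have := wE i; rewrite !mxE => -> h; ring: h.
  by move/eqP; rewrite mulf_eq0 subr_eq0 => /orP[]/eqP; [left|right].
have t0 : t != 0.
  apply: contraNneq w0 => t0; apply/eqP/rowP => i; rewrite mxE.
  by case: (wV i) => ->.
move: aw a1; rewrite !sum3 => aw a1.
have cancel_t x : x * t = 0 -> x = 0.
  by move/eqP; rewrite mulf_eq0 (negPf t0) orbF => /eqP.
case: (wV 0) (wV 1) (wV 2%:R) aw => [w_0|w_0] [w_1|w_1] [w_2|w_2];
  rewrite w_0 w_1 w_2 ?mulr0 ?add0r ?addr0 -?mulrDl => aw.
(* One case for each subset of the coordinates on which w takes the value t. *)
- case/eqP: w0; apply/rowP => i; rewrite mxE.
  case: i => [[|[|[|//]]] lti].
  + by rewrite -[RHS]w_0; congr (w 0 _); apply/val_inj.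
  + by rewrite -[RHS]w_1; congr (w 0 _); apply/val_inj.
  + by rewrite -[RHS]w_2; congr (w 0 _); apply/val_inj.
- by have := a0 2%:R; rewrite (cancel_t _ aw) eqxx.
- by have := a0 1; rewrite (cancel_t _ aw) eqxx.
- by exists 0; rewrite -a1 -addrA (cancel_t _ aw) addr0.
- by have := a0 0; rewrite (cancel_t _ aw) eqxx.
- by exists 1; rewrite -a1 addrAC (cancel_t _ aw) add0r.
- by exists 2%:R; rewrite -a1 (cancel_t _ aw) add0r.
- by have := oner_neq0 F; rewrite -a1 (cancel_t _ aw) eqxx.
Qed.

(** Dividing by x, y and z and taking differences of the eight equations
    reduces this to the normalized form. *)
Lemma box_in_plane (F : fieldType) (x x' y y' z z' : 'rV[F]_3) :
    (forall i, x 0 i != 0) -> (forall i, y 0 i != 0) ->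
    (forall i, z 0 i != 0) -> x != x' -> y != y' -> z != z' ->
    (forall X Y Z, X \in [:: x; x'] -> Y \in [:: y; y'] -> Z \in [:: z; z'] ->
      \sum_i X 0 i * Y 0 i * Z 0 i = 1) ->
  exists i, x 0 i * y 0 i * z 0 i = 1.
Proof.
move=> x0 y0 z0 xx' yy' zz' H.
pose a : 'rV[F]_3 := \row_i (x 0 i * y 0 i * z 0 i).
pose nrm (s s' : 'rV[F]_3) : 'rV[F]_3 := \row_i (s' 0 i / s 0 i - 1).
have nrm0 (s s' : 'rV[F]_3) :
    (forall i, s 0 i != 0) -> s != s' -> nrm s s' != 0.
  move=> s0; apply: contraNneq => /rowP sE; apply/eqP/rowP => i.
  have /eqP := sE i; rewrite !mxE subr_eq0 => /eqP h.
  by rewrite -[LHS]mul1r -h divfK.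
have [i] : exists i, a 0 i = 1; last by rewrite mxE => ?; exists i.
have in1 (s s' : 'rV[F]_3) : s \in [:: s; s'] by rewrite inE eqxx.
have in2 (s s' : 'rV[F]_3) : s' \in [:: s; s'] by rewrite !inE eqxx orbT.
pose T (X Y Z : 'rV[F]_3) := \sum_i X 0 i * Y 0 i * Z 0 i.
have T1 X Y Z : X \in [:: x; x'] -> Y \in [:: y; y'] -> Z \in [:: z; z'] ->
  T X Y Z = 1 by exact: H.
have TE := (T1 _ _ _ (in1 _ _) (in1 _ _) (in1 _ _),
            T1 _ _ _ (in1 _ _) (in1 _ _) (in2 _ _),
            T1 _ _ _ (in1 _ _) (in2 _ _) (in1 _ _),
            T1 _ _ _ (in1 _ _) (in2 _ _) (in2 _ _),
            T1 _ _ _ (in2 _ _) (in1 _ _) (in1 _ _),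
            T1 _ _ _ (in2 _ _) (in1 _ _) (in2 _ _),
            T1 _ _ _ (in2 _ _) (in2 _ _) (in1 _ _),
            T1 _ _ _ (in2 _ _) (in2 _ _) (in2 _ _)).
apply: (box_in_plane_normalized _ a (nrm x x') (nrm y y') (nrm z z')).
- by move=> i; rewrite mxE !mulf_neq0.
- by rewrite -[RHS](TE.1); apply: eq_bigr => i _; rewrite mxE.
- exact: nrm0.
- exact: nrm0.
- exact: nrm0.
- transitivity (T x' y z - T x y z); last by rewrite !TE; ring.
  rewrite /T -sumrB; apply: eq_bigr => i _; rewrite !mxE; field; exact: x0.
- transitivity (T x y' z - T x y z); last by rewrite !TE; ring.
  rewrite /T -sumrB; apply: eq_bigr => i _; rewrite !mxE; field; exact: y0.
- transitivity (T x y z' - T x y z); last by rewrite !TE; ring.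
  rewrite /T -sumrB; apply: eq_bigr => i _; rewrite !mxE; field; exact: z0.
- transitivity ((T x' y' z - T x' y z) - (T x y' z - T x y z)).
    rewrite /T -!sumrB; apply: eq_bigr => i _; rewrite !mxE; field.
    by rewrite x0 y0.
  by rewrite !TE; ring.
- transitivity ((T x y' z' - T x y' z) - (T x y z' - T x y z)).
    rewrite /T -!sumrB; apply: eq_bigr => i _; rewrite !mxE; field.
    by rewrite y0 z0.
  by rewrite !TE; ring.
- transitivity ((T x' y z' - T x' y z) - (T x y z' - T x y z)).
    rewrite /T -!sumrB; apply: eq_bigr => i _; rewrite !mxE; field.
    by rewrite x0 z0.
  by rewrite !TE; ring.
- transitivity (((T x' y' z' - T x' y' z) - (T x' y z' - T x' y z)) -
                ((T x y' z' - T x y' z) - (T x y z' - T x y z))).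
    rewrite /T -!sumrB; apply: eq_bigr => i _; rewrite !mxE; field.
    by rewrite x0 y0 z0.
  by rewrite !TE; ring.
Qed.

(** * The free set *)

(** Coordinatewise discrete exponentiation: it carries addition of exponents to
    multiplication in F as soon as g is a primitive root of order k + 1. *)
Definition powv {F : fieldType} {k : nat} (g : F) (v : 'rV[Zmod k.+1]_3) :
  'rV[F]_3 := \row_i g ^+ (v 0 i : 'I_k.+1).

Definition plane_set {F : fieldType} (k : nat) (g : F) :
    {set 'rV[Zmod k.+1]_3} :=
  [set v | (\sum_i powv g v 0 i == 1) && [forall i, powv g v 0 i != 1]].

Section PrimitiveRoot.

Context {F : fieldType} {k : nat} {g : F} (prim_g : k.+1.-primitive_root g).

Lemma powvD (v w : 'rV[Zmod k.+1]_3) i :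
  powv g (v + w) 0 i = powv g v 0 i * powv g w 0 i.
Proof. by rewrite !mxE -exprD -(prim_expr_mod prim_g (_ + _)). Qed.

Lemma powv_neq0 (v : 'rV[Zmod k.+1]_3) i : powv g v 0 i != 0.
Proof.
rewrite mxE expf_neq0 //; apply: contra_eq_neq (prim_expr_order prim_g) => ->.
by rewrite expr0n eq_sym oner_eq0.
Qed.

Lemma powv_inj : injective (@powv F k g).
Proof.
move=> v w /rowP vw; apply/rowP => i; have := vw i; rewrite !mxE => /eqP.
by rewrite (eq_prim_root_expr prim_g) => /eqP; rewrite !modn_small // => /val_inj.
Qed.

Lemma plane_set_free : L222_free (plane_set k g).
Proof.
apply/forallP => L1; apply/forallP => L2; apply/forallP => L3.
apply/implyP => /and3P[/cards2P[x [x' [xx' ->]]] /cards2P[y [y' [yy' ->]]]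
  /cards2P[z [z' [zz' ->]]]].
apply/negP => /subsetP sub.
have inA X Y Z : X \in [:: x; x'] -> Y \in [:: y; y'] -> Z \in [:: z; z'] ->
    X + Y + Z \in plane_set k g.
  move=> hX hY hZ; apply/sub/imset2_f; last by move: hZ; rewrite !inE.
  by apply: imset2_f; [move: hX|move: hY]; rewrite !inE.
have [i] : exists i, powv g x 0 i * powv g y 0 i * powv g z 0 i = 1.
  apply: (box_in_plane _ _ (powv g x') _ (powv g y') _ (powv g z'));
    rewrite ?(inj_eq powv_inj) //; try exact: powv_neq0.
  move=> X Y Z /(@mapP _ _ (powv g) [:: x; x'])[X0 hX ->].
  move=> /(@mapP _ _ (powv g) [:: y; y'])[Y0 hY ->].
  move=> /(@mapP _ _ (powv g) [:: z; z'])[Z0 hZ ->].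
  have := inA _ _ _ hX hY hZ; rewrite inE => /andP[/eqP <- _].
  by apply: eq_bigr => i _; rewrite !powvD.
have := inA x y z; rewrite !inE !eqxx => /(_ isT isT isT)/andP[_ /forallP/(_ i)].
by rewrite !powvD => /eqP.
Qed.

End PrimitiveRoot.

(** * Counting points *)

(** The third coordinate 1 - x - y of a point of the plane is 0 or 1 when
    x + y is 1 or 0. *)
Definition plane_section (F : finFieldType) : {set F * F} :=
  [set q | [&& q.1 \notin [set 0; 1], q.2 \notin [set 0; 1] &
               q.1 + q.2 \notin [set 0; 1]]].

Lemma card_plane_section_ge (F : finFieldType) : (1 : F) != -1 ->
  ((#|F| - 3) ^ 2 <= #|plane_section F|)%N.
Proof.
move=> one_neg.
pose C (x : F) : {set F} := ~: [set y in [:: 0; 1; 1 - x; - x]].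
have -> : #|plane_section F| = (\sum_(x in ~: [set 0%R; 1%R]) #|C x|)%N.
  rewrite -sum1_card.
  under [RHS]eq_bigr do rewrite -sum1_card.
  rewrite pair_big_dep; apply: eq_bigl => -[x y]; rewrite !inE /=.
  have -> : (y == 1 - x) = (x + y == 1) by rewrite eq_sym subr_eq eq_sym addrC.
  have -> : (y == - x) = (x + y == 0) by rewrite -addr_eq0 addrC.
  by do 6 case: (_ == _).
(* An upper bound on the size of a list bounds the set it spans even when
   entries coincide, as 1 and - x do for x = -1. *)
have cardCs (s : seq F) : (#|F| - size s <= #|~: [set y in s]|)%N.
  by rewrite leq_subLR -(cardsC [set y in s]) leq_add2r cardsE card_size.
have C_ge x : (#|F| - 4 <= #|C x|)%N by exact: cardCs.
have C_neg1 : (#|F| - 3 <= #|C (-1)%R|)%N.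
  apply: leq_trans (cardCs [:: 0; 1; 1 - -1]) (subset_leq_card _).
  by apply/subsetP => y; rewrite !inE opprK; do 3 case: (_ == _).
have neg1_in : -1 \in ~: [set (0 : F); 1].
  by rewrite !inE oppr_eq0 oner_eq0 eq_sym.
have card_x : #|(~: [set 0%R; 1%R]) :\ (-1 : F)%R| = (#|F| - 3)%N.
  have := cardsD1 (-1 : F) (~: [set 0; 1]); have := cardsC [set (0 : F); 1].
  by rewrite neg1_in cards2 eq_sym oner_eq0 => <- ->; rewrite addnA addKn.
rewrite (big_setD1 _ neg1_in) /=.
have : (\sum_(x in (~: [set 0%R; 1%R]) :\ (-1 : F)%R) (#|F| - 4) <=
    \sum_(x in (~: [set 0%R; 1%R]) :\ (-1 : F)%R) #|C x|)%N by exact: leq_sum.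
rewrite sum_nat_const card_x => sum_ge; apply: leq_trans (leq_add C_neg1 sum_ge).
by rewrite [(_ - 4)%N]subnS; case: (_ - 3)%N => // r; rewrite -mulnS.
Qed.

(** Every nonzero element of F is a power of the generator, so each point of the
    plane section comes from an element of the free set. *)
Lemma F_L222_finField_ge (F : finFieldType) : (1 : F) != -1 ->
  ((#|F| - 3) ^ 2 <= F_L222 'rV[Zmod (#|F| - 1)]_3)%N.
Proof.
move=> one_neg.
have : (0 < #|F| - 1)%N by rewrite subn_gt0 finNzRing_gt1.
case cF: (#|F| - 1)%N => [//|k] _.
have pow1 (x : F) : x != 0 -> x ^+ k.+1 = 1.
  move=> x0; apply: (mulfI x0); rewrite -exprS mulr1 -cF subn1 prednK.
    exact: expf_card.
  exact: ltnW (finNzRing_gt1 F).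
have [g prim_g] : exists g : F, k.+1.-primitive_root g.
  pose s := enum (predC1 (0 : F)).
  have /hasP[g _ ?] : has k.+1.-primitive_root s; last by exists g.
  apply: has_prim_root; rewrite ?enum_uniq //.
    by apply/allP => x; rewrite mem_enum inE => /pow1/unity_rootP.
  by rewrite -cardE cardC1 -subn1 cF.
have pow_surj (x : F) : x != 0 -> exists i : 'I_k.+1, x = g ^+ i.
  by move=> /pow1/(prim_rootP prim_g)[i ->]; exists i.
apply: leq_trans (card_plane_section_ge _ one_neg) _.
pose pr (v : 'rV[Zmod k.+1]_3) := (powv g v 0 0, powv g v 0 1).
apply: (@leq_trans #|plane_set k g|); last first.
  exact: (@leq_bigmax_cond _ _ (fun A : {set _} => #|A|)) (plane_set_free prim_g).
apply: leq_trans (leq_imset_card pr _); apply/subset_leq_card/subsetP => -[x y].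
rewrite !inE /= !negb_or => /and3P[/andP[x0 x1] /andP[y0 y1] /andP[xy0 xy1]].
have z0 : 1 - (x + y) != 0 by rewrite subr_eq0 eq_sym.
have z1 : 1 - (x + y) != 1 by rewrite -subr_eq0 addrAC subrr sub0r oppr_eq0.
have [i xE] := pow_surj x x0; have [j yE] := pow_surj y y0.
have [l zE] := pow_surj _ z0.
pose v : 'rV[Zmod k.+1]_3 := \row_n tnth [tuple i; j; l] n.
have [v0 v1 v2] : [/\ powv g v 0 0 = x, powv g v 0 1 = y &
    powv g v 0 2%:R = 1 - (x + y)] by rewrite zE xE yE !mxE.
apply/imsetP; exists v; last by rewrite /pr v0 v1.
rewrite inE sum3 v0 v1 v2 addrC subrK eqxx /=; apply/forallP => n.
have : n \in [:: 0; 1; 2%:R] by case: n => [[|[|[|//]]] ltn].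
by rewrite !inE => /or3P[]/eqP->; rewrite ?v0 ?v1 ?v2.
Qed.

Theorem theorem3 (p : nat) (hp : prime p) :
  (p%:Z - 3) ^+ 2 <= (F_L222 'rV[Zmod (p - 1)]_3)%:Z.
Proof.
have [-> | p2] := eqVneq p 2%N.
  suff : (1 <= F_L222 'rV[Zmod (2 - 1)]_3)%N by lia.
  rewrite -{1}(cards1 (0 : 'rV[Zmod (2 - 1)]_3)).
  apply: (@leq_bigmax_cond _ _ (fun A : {set _} => #|A|)).
  apply/forallP => L1; apply/forallP => L2; apply/forallP => L3.
  apply/implyP => /andP[/cards2P[x [y [/eqP xy _]]] _]; case: xy.
  by apply/rowP => i; rewrite [x 0 i]ord1 [y 0 i]ord1.
have p_gt2 : (2 < p)%N by rewrite ltn_neqAle eq_sym p2 prime_gt1.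
have one_neg : (1 : 'F_p) != -1.
  rewrite -addr_eq0 -[1 + 1]/(2%:R) -(dvdn_pcharf (pchar_Fp hp)).
  by rewrite gtnNdvd.
have := F_L222_finField_ge _ one_neg; rewrite card_Fp // => h.
have -> : p%:Z - 3 = (p - 3)%N%:Z by lia.
by rewrite expr2 -PoszM mulnn lez_nat.
Qed.
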